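(* Let $a\ne b$. The spherical tiling by $12$ edge congruent pentagons with edge lengths $a,a,a,b,b$ is, up to symmetries, given by the following assignment of lengths to the edges of the dodecahedral pattern: the edges $$E_{1,2},E_{1,3},E_{2,3},\;E_{4,8},E_{4,9},E_{8,9},\;E_{5,6},E_{5,10},E_{6,10},\;E_{7,11},E_{7,12},E_{11,12}$$ have length $b$, and all other edges have length $a$.
   Context: A spherical tiling by $12$ pentagons (graph embedded in $S^2$ with all vertices of degree $\ge 3$, every tile a five-edged region enclosed by a simple closed curve; edges may be any nice curves) is combinatorially the dodecahedral pattern: tiles $P_1,\dots,P_{12}$, where $P_i$ with list $(n_1,\dots,n_5)$ has edges in cyclic order $E_{i,n_1},\dots,E_{i,n_5}$, $E_{i,j}=E_{j,i}$ being the common edge of $P_i$ and $P_j$, and (with $n_6=n_1$) $E_{i,n_k},E_{i,n_{k+1}}$ meet at the vertex $V_{i,n_k,n_{k+1}}$ of degree $3$ shared by $P_i,P_{n_k},P_{n_{k+1}}$: $P_1:(2,3,4,5,6)$; $P_2:(1,6,11,7,3)$; $P_3:(1,2,7,8,4)$; $P_4:(1,3,8,9,5)$; $P_5:(1,4,9,10,6)$; $P_6:(1,5,10,11,2)$; $P_7:(12,8,3,2,11)$; $P_8:(12,9,4,3,7)$; $P_9:(12,10,5,4,8)$; $P_{10}:(12,11,6,5,9)$; $P_{11}:(12,7,2,6,10)$; $P_{12}:(7,11,10,9,8)$. An edge congruent tiling is considered as an assignment of lengths to the $30$ edges such that all tiles are edge congruent, i.e. for any two tiles there is an adjacency-preserving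 correspondence of their edges that preserves lengths. No geometric realization by great arcs is required. ''Up to symmetries'' means up to symmetries of the dodecahedral pattern (including reflections). *)

(* Defs.v *)
From HB Require Import structures.
From mathcomp Require Import all_boot all_order all_fingroup all_algebra.
From mathcomp Require Import reals.

Set Implicit Arguments.
Unset Strict Implicit.
Unset Printing Implicit Defensive.

Import Order.TTheory GRing.Theory Num.Theory.

Inductive tile : Type :=
  P1 | P2 | P3 | P4 | P5 | P6 | P7 | P8 | P9 | P10 | P11 | P12.

Definition tile_enum : seq tile :=
  [:: P1; P2; P3; P4; P5; P6; P7; P8; P9; P10; P11; P12].

Definition tile_code (i : tile) : 'I_12 :=
  match i with
  | P1 => @Ordinal 12 0 isT | P2 => @Ordinal 12 1 isT
  | P3 => @Ordinal 12 2 isT | P4 => @Ordinal 12 3 isT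
  | P5 => @Ordinal 12 4 isT | P6 => @Ordinal 12 5 isT
  | P7 => @Ordinal 12 6 isT | P8 => @Ordinal 12 7 isT
  | P9 => @Ordinal 12 8 isT | P10 => @Ordinal 12 9 isT
  | P11 => @Ordinal 12 10 isT | P12 => @Ordinal 12 11 isT
  end.

Definition tile_decode (k : 'I_12) : tile := nth P1 tile_enum k.

Lemma tile_codeK : cancel tile_code tile_decode.
Proof. by case. Qed.

HB.instance Definition _ := Finite.copy tile (can_type tile_codeK).

(* The neighbours of each tile, in the cyclic order in which its five edges
   are shared with them. *)
Definition nbrs (i : tile) : 5.-tuple tile :=
  match i with
  | P1  => [tuple P2; P3; P4; P5; P6]
  | P2  => [tuple P1; P6; P11; P7; P3]
  | P3  => [tuple P1; P2; P7; P8; P4]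
  | P4  => [tuple P1; P3; P8; P9; P5]
  | P5  => [tuple P1; P4; P9; P10; P6]
  | P6  => [tuple P1; P5; P10; P11; P2]
  | P7  => [tuple P12; P8; P3; P2; P11]
  | P8  => [tuple P12; P9; P4; P3; P7]
  | P9  => [tuple P12; P10; P5; P4; P8]
  | P10 => [tuple P12; P11; P6; P5; P9]
  | P11 => [tuple P12; P7; P2; P6; P10]
  | P12 => [tuple P7; P11; P10; P9; P8]
  end.

Definition nbr (i : tile) (k : 'I_5) : tile := tnth (nbrs i) k.

(* An edge E_{i,j} = E_{j,i} is represented by the pair {P_i, P_j} of tiles
   sharing it, and a vertex V_{i,j,k} by the triple {P_i, P_j, P_k}. *)
Definition is_edge (e : {set tile}) : bool :=
  [exists i : tile, [exists k : 'I_5, e == [set i; nbr i k]]].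

Definition is_vertex (v : {set tile}) : bool :=
  [exists i : tile, [exists k : 'I_5,
     v == [set i; nbr i k; nbr i (ordS k)]]].

Definition edge : Type := {e : {set tile} | is_edge e}.

Lemma side_subproof (i : tile) (k : 'I_5) : is_edge [set i; nbr i k].
Proof. by apply/existsP; exists i; apply/existsP; exists k. Qed.

Definition side (i : tile) (k : 'I_5) : edge :=
  exist _ [set i; nbr i k] (side_subproof i k).

(* Symmetries, reflections included, are the combinatorial automorphisms of
   the pattern; by finiteness, mapping edges to edges and vertices to vertices
   implies the same for the inverse permutation. *)
Record symmetry : Type := Symmetry {
  symmetry_perm :> {perm tile};
  symmetry_edge : forall e : {set tile},
    is_edge e -> is_edge [set symmetry_perm i | i in e];
  symmetry_vertex : forall v : {set tile},
    is_vertex v -> is_vertex [set symmetry_perm i | i in v] }.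

Definition edge_image (g : symmetry) (e : edge) : edge :=
  exist _ [set g i | i in val e] (symmetry_edge g (valP e)).

Definition adjacent_sides (k l : 'I_5) : bool := (l == ordS k) || (k == ordS l).

Definition edge_congruent_tiles (R : realType) (len : edge -> R) (i j : tile)
    : Prop :=
  exists f : {perm 'I_5},
    (forall k l, adjacent_sides k l -> adjacent_sides (f k) (f l)) /\
    (forall k, len (side j (f k)) = len (side i k)).

Definition edge_congruent_tiling (R : realType) (len : edge -> R) : Prop :=
  forall i j : tile, edge_congruent_tiles len i j.

Definition tile_lengths (R : realType) (len : edge -> R) (i : tile) : seq R :=
  [seq len (side i k) | k <- enum 'I_5].

Definition b_edges : seq {set tile} :=
  [:: [set P1; P2]; [set P1; P3]; [set P2; P3];
      [set P4; P8]; [set P4; P9]; [set P8; P9];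
      [set P5; P6]; [set P5; P10]; [set P6; P10];
      [set P7; P11]; [set P7; P12]; [set P11; P12]].

Definition standard_lengths (R : realType) (a b : R) (e : edge) : R :=
  if val e \in b_edges then b else a.

(* Main.v *)
(** Colour an edge by whether its length is [b].  Around every tile the two
    [b]-edges are cyclically adjacent, or around every tile they are not;
    filling in the tiles one after the other and discarding conflicts leaves
    no colouring in the second case and ten in the first.  In each of these
    ten the [b]-edges are those at four vertices forming a regular
    tetrahedron.  The symmetries preserving a tetrahedron act freely on the
    tiles, so the dihedral stabilizer of [P1], of order ten, acts simply
    transitively on the ten tetrahedra and provides the required symmetry. *)
Require Import Defs.
From mathcomp Require Import all_boot all_order all_fingroup all_algebra.
From mathcomp Require Import reals.

Set Implicit Arguments.
Unset Strict Implicit.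
Unset Printing Implicit Defensive.

(** * Computable indices and small sets *)

Lemma mem_tile_enum (i : tile) : i \in tile_enum.
Proof. by case: i. Qed.

(* Unlike [enum 'I_5], this list can be computed. *)
Definition side_indices : seq 'I_5 := traject (@ordS 5) ord0 5.

Lemma enum_side_indices : enum 'I_5 = side_indices.
Proof. by apply: (inj_map val_inj); rewrite val_enum_ord. Qed.

Lemma mem_side_indices (k : 'I_5) : k \in side_indices.
Proof. by rewrite -enum_side_indices mem_enum. Qed.

Lemma eq_set2 (T : finType) (x y z t : T) :
  ([set x; y] == [set z; t]) =
  ((x == z) && (y == t)) || ((x == t) && (y == z)).
Proof.
apply/eqP/idP => [eq_xy|]; last first.
  by case/orP => /andP[/eqP-> /eqP->]; rewrite // setUC.
have := set21 x y; have := set22 x y; rewrite eq_xy !inE => yP xP.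
have := set21 z t; have := set22 z t; rewrite -eq_xy !inE => {eq_xy}.
by move: yP xP; do 4![case/orP => /eqP ?]; subst; rewrite ?eqxx /= ?orbT.
Qed.

Lemma imset_set2 (aT rT : finType) (f : aT -> rT) (x y : aT) :
  [set f z | z in [set x; y]] = [set f x; f y].
Proof. by rewrite imsetU !imset_set1. Qed.

Lemma imset_set3 (aT rT : finType) (f : aT -> rT) (x y z : aT) :
  [set f t | t in [set x; y; z]] = [set f x; f y; f z].
Proof. by rewrite !imsetU !imset_set1. Qed.

(** * Neighbours and vertices of the pattern *)

Lemma nbr_inj (i : tile) : injective (nbr i).
Proof. by apply/tuple_uniqP; case: i. Qed.

Lemma nbrP (i j : tile) : reflect (exists k, j = nbr i k) (j \in nbrs i).
Proof. exact: tnthP. Qed.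

Lemma nbrs_sym (i j : tile) : (j \in nbrs i) = (i \in nbrs j).
Proof. by case: i; case: j. Qed.

Lemma nbrs_irrefl (i : tile) : i \notin nbrs i.
Proof. by case: i. Qed.

Lemma is_edgeE (i j : tile) : is_edge [set i; j] = (j \in nbrs i).
Proof.
apply/existsP/nbrP => [[i' /existsP[k]]|[k ->]]; last first.
  by exists i; apply/existsP; exists k.
rewrite eq_set2 => /orP[] /andP[/eqP-> /eqP->]; first by exists k.
by apply/nbrP; rewrite nbrs_sym; apply/nbrP; exists k.
Qed.

(* Since the lists of neighbours are coherently oriented, the tiles around a
   vertex may be listed from any of them. *)
Lemma nbr_turn (i : tile) (k : 'I_5) :
  exists m, nbr (nbr i k) m = nbr i (ordS k) /\ nbr (nbr i k) (ordS m) = i.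
Proof.
have /allP/(_ i (mem_tile_enum i)) : all (fun i => all (fun k => has (fun m =>
    (nbr (nbr i k) m == nbr i (ordS k)) && (nbr (nbr i k) (ordS m) == i))
  side_indices) side_indices) tile_enum by vm_compute.
move=> /allP/(_ k (mem_side_indices k))/hasP[m _ /andP[/eqP ? /eqP ?]].
by exists m.
Qed.

(** Two uses of [nbr_turn] list the vertex from each of its other two tiles. *)
Lemma vertex_at (v : {set tile}) (i : tile) :
  is_vertex v -> i \in v ->
  exists m, v = [set i; nbr i m; nbr i (ordS m)].
Proof.
case/existsP => j /existsP[k /eqP->]; rewrite !inE -orbA.
have [m [m1 m2]] := nbr_turn j k; have [n [n1 n2]] := nbr_turn (nbr j k) m.
rewrite m1 m2 in n1 n2.
case/or3P => /eqP->; first by exists k.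
- by exists m; rewrite m1 m2 -setUA setUC.
- by exists n; rewrite n1 n2 setUC setUA.
Qed.

Lemma neq_ordS (k : 'I_5) : k != ordS k.
Proof. by case: k => [[|[|[|[|[|]]]]] ?]. Qed.

Lemma vertex_adjacent (i : tile) (k l : 'I_5) :
  k != l -> is_vertex [set i; nbr i k; nbr i l] -> adjacent_sides k l.
Proof.
move=> neq_kl /(@vertex_at _ i)[|m eq_v]; first by rewrite !inE eqxx.
have mem_m x : nbr i x \in [set i; nbr i k; nbr i l] -> (x == m) || (x == ordS m).
  have : nbr i x != i by apply: contraNneq (nbrs_irrefl i) => ?; apply/nbrP; exists x.
  by rewrite eq_v !inE !(inj_eq (@nbr_inj i)) -orbA => /negPf->.
have := mem_m k; have := mem_m l; rewrite !inE !eqxx !orbT /=.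
move=> /(_ isT)/orP[]/eqP el /(_ isT)/orP[]/eqP ek; subst;
  by rewrite /adjacent_sides ?eqxx ?orbT // eqxx in neq_kl *.
Qed.

(** * Automorphisms of the cycle of sides, and congruence *)

Definition side_aut (f : {perm 'I_5}) : Prop :=
  forall k l, adjacent_sides k l -> adjacent_sides (f k) (f l).

Lemma side_autM f g : side_aut f -> side_aut g -> side_aut (f * g)%g.
Proof. by move=> Af Ag k l /Af/Ag; rewrite !permM. Qed.

Lemma side_autX f n : side_aut f -> side_aut (f ^+ n)%g.
Proof.
move=> Af; elim: n => [k l|n IHn]; first by rewrite !perm1.
by rewrite expgS; apply: side_autM.
Qed.

(** Inverses in a finite group are powers, so an implication in one direction is enough. *)
Lemma side_autV f : side_aut f -> side_aut f^-1%g.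
Proof. by rewrite invg_expg; apply: side_autX. Qed.

Lemma side_aut_ordS : side_aut (perm (@ordS_inj 5)).
Proof. by move=> k l; rewrite /adjacent_sides !permE !(inj_eq (@ordS_inj 5)). Qed.

Section CongruentSides.

Variable T : eqType.
Implicit Types u v w : 'I_5 -> T.

(** Values lie in any [eqType], to serve for lengths and colours alike. *)
Definition congruent_sides u v : Prop :=
  exists f : {perm 'I_5}, side_aut f /\ (forall k, v (f k) = u k).

Lemma congruent_sides_sym u v : congruent_sides u v -> congruent_sides v u.
Proof.
case=> f [Af uv]; exists f^-1%g; split; first exact: side_autV.
by move=> k; rewrite -uv permKV.
Qed.

Lemma congruent_sides_trans u v w :
  congruent_sides u v -> congruent_sides v w -> congruent_sides u w.
Proof.
case=> f [Af uv] [g [Ag vw]]; exists (f * g)%g; split; first exact: side_autM.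
by move=> k; rewrite permM vw.
Qed.

Lemma congruent_sides_perm u v :
  congruent_sides u v -> perm_eq [seq u k | k <- enum 'I_5] [seq v k | k <- enum 'I_5].
Proof.
case=> f [_ uv]; rewrite -(eq_map uv) (map_comp v f) perm_map //.
apply: uniq_perm; rewrite ?(map_inj_uniq perm_inj) ?enum_uniq // => k.
by rewrite mem_enum; apply/mapP; exists (f^-1%g k); rewrite ?mem_enum ?permKV.
Qed.

End CongruentSides.

(** Preservation of edges yields the map [f]; preservation of vertices makes it respect
    adjacency. *)
Lemma symmetry_sides (g : symmetry) (j : tile) :
  exists f, side_aut f /\
    (forall k, side (g j) (f k) = edge_image g (side j k)).
Proof.
have nbr_g k : {m | g (nbr j k) == nbr (g j) m}.
  apply/sigW; have := symmetry_edge g (side_subproof j k).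
  by rewrite imset_set2 is_edgeE => /nbrP[m ->]; exists m.
pose f k := sval (nbr_g k).
have fE k : nbr (g j) (f k) = g (nbr j k) by have /eqP := svalP (nbr_g k).
have f_inj : injective f.
  by move=> k l /(congr1 (nbr (g j))); rewrite !fE => /perm_inj/nbr_inj.
have vertex_f k : is_vertex [set g j; nbr (g j) (f k); nbr (g j) (f (ordS k))].
  rewrite !fE -imset_set3; apply: symmetry_vertex.
  by apply/existsP; exists j; apply/existsP; exists k.
have adj_f k : adjacent_sides (f k) (f (ordS k)).
  by apply: vertex_adjacent (vertex_f k); rewrite (inj_eq f_inj) neq_ordS.
exists (perm f_inj); split => [k l|k].
  rewrite !permE => /orP[]/eqP->; first exact: adj_f.
  by have := adj_f l; rewrite /adjacent_sides orbC.
by apply: val_inj; rewrite /= permE imset_set2 fE.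
Qed.

(** * Symmetric images of the standard lengths *)

Definition b_pairs : seq (tile * tile) :=
  [:: (P1, P2); (P1, P3); (P2, P3); (P4, P8); (P4, P9); (P8, P9);
      (P5, P6); (P5, P10); (P6, P10); (P7, P11); (P7, P12); (P11, P12)].

(** A form of membership in [b_edges] that [vm_compute] can evaluate. *)
Definition b_pair (i j : tile) : bool :=
  ((i, j) \in b_pairs) || ((j, i) \in b_pairs).

Lemma mem_b_edges (i j : tile) : ([set i; j] \in b_edges) = b_pair i j.
Proof.
have -> : b_edges = [seq [set p.1; p.2] | p <- b_pairs] by [].
apply/mapP/orP => [[[k l] kl /eqP]|[]]; last 2 first.
- by exists (i, j).
- by exists (j, i); rewrite // setUC.
by rewrite eq_set2 /= => /orP[]/andP[/eqP-> /eqP->]; [left | right].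
Qed.

Lemma standard_lengths_side (R : realType) (a b : R) (i : tile) (k : 'I_5) :
  standard_lengths a b (side i k) = if b_pair i (nbr i k) then b else a.
Proof. by rewrite /standard_lengths mem_b_edges. Qed.

(** The two [b]-sides of each tile are consecutive, so a rotation by some [r] suffices. *)
Lemma standard_lengths_congruent (R : realType) (a b : R) (i : tile) :
  congruent_sides (fun k => standard_lengths a b (side P1 k))
                  (fun k => standard_lengths a b (side i k)).
Proof.
have /allP/(_ i (mem_tile_enum i))/hasP[r _ /allP br] :
  all (fun i => has (fun r => all (fun k =>
      b_pair i (nbr i (iter r (@ordS 5) k)) == b_pair P1 (nbr P1 k))
    side_indices) (iota 0 5)) tile_enum by vm_compute.
exists (perm (@ordS_inj 5) ^+ r)%g.
split=> [|k]; first exact/side_autX/side_aut_ordS.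
rewrite !standard_lengths_side permX (eq_iter (f' := @ordS 5)); last exact: permE.
by rewrite (eqP (br k (mem_side_indices k))).
Qed.

Lemma map_nbr (T : Type) (f : tile -> T) (i : tile) :
  [seq f (nbr i k) | k <- enum 'I_5] = [seq f j | j <- nbrs i].
Proof. by rewrite (map_comp f) map_tnth_enum. Qed.

Lemma standard_lengths_perm (R : realType) (a b : R) :
  perm_eq (tile_lengths (standard_lengths a b) P1) [:: a; a; a; b; b].
Proof.
rewrite /tile_lengths (eq_map (standard_lengths_side a b P1)).
rewrite (map_nbr (fun j => if b_pair P1 j then b else a)) /=.
by apply/permPl; apply: (perm_rot 3 [:: a; a; a; b; b]).
Qed.

Lemma symmetric_lengths (R : realType) (a b : R) (len : edge -> R) (g : symmetry) :
  (forall e, len (edge_image g e) = standard_lengths a b e) ->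
  edge_congruent_tiling len /\
  forall i, perm_eq (tile_lengths len i) [:: a; a; a; b; b].
Proof.
move=> len_g.
have cong_std i : congruent_sides (fun k => standard_lengths a b (side P1 k))
                                  (fun k => len (side i k)).
  (* Every tile is the image under [g] of some tile, to which [symmetry_sides] applies. *)
  rewrite -(permKV (symmetry_perm g) i); move: ((symmetry_perm g)^-1%g i) => {}i.
  apply: congruent_sides_trans (standard_lengths_congruent a b i) _.
  have [f [Af gf]] := symmetry_sides g i.
  by exists f; split=> // k; rewrite gf len_g.
split=> [i j|i].
  exact: congruent_sides_trans (congruent_sides_sym (cong_std i)) (cong_std j).
have := congruent_sides_perm (cong_std i).
by rewrite perm_sym => /perm_trans; apply; apply: standard_lengths_perm.
Qed.

(** * The dihedral stabilizer of [P1] *)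

Definition turn (i : tile) : tile :=
  match i with
  | P1 => P1 | P2 => P3 | P3 => P4 | P4 => P5 | P5 => P6 | P6 => P2
  | P7 => P8 | P8 => P9 | P9 => P10 | P10 => P11 | P11 => P7 | P12 => P12
  end.

Definition flip (i : tile) : tile :=
  match i with
  | P1 => P1 | P2 => P2 | P3 => P6 | P4 => P5 | P5 => P4 | P6 => P3
  | P7 => P11 | P8 => P10 | P9 => P9 | P10 => P8 | P11 => P7 | P12 => P12
  end.

(** [turn] is a rotation of order five about the axis through [P1] and [P12], and [flip] a
    reflection fixing both. *)
Definition dihedral (rs : nat * nat) (i : tile) : tile :=
  iter rs.1 turn (iter rs.2 flip i).

Definition dihedral_indices : seq (nat * nat) :=
  [seq (r, s) | r <- iota 0 5, s <- iota 0 2].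

Lemma iter_inj (T : Type) (f : T -> T) n : injective f -> injective (iter n f).
Proof. by move=> f_inj; elim: n => //= n IHn x y /f_inj/IHn. Qed.

Lemma dihedral_inj rs : injective (dihedral rs).
Proof.
apply: inj_comp; apply: iter_inj; last by apply: inv_inj; case.
by apply: (can_inj (g := iter 4 turn)); case.
Qed.

(** Reflections reverse the order of consecutive sides, hence the unordered pairs. *)
Lemma dihedral_nbr rs i k : rs \in dihedral_indices ->
  exists m, [set dihedral rs (nbr i k); dihedral rs (nbr i (ordS k))] =
            [set nbr (dihedral rs i) m; nbr (dihedral rs i) (ordS m)].
Proof.
have /allP H : all (fun rs => all (fun i => all (fun k => has (fun m =>
    let x := dihedral rs (nbr i k) in
    let y := dihedral rs (nbr i (ordS k)) in
    let z := nbr (dihedral rs i) m in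
    let t := nbr (dihedral rs i) (ordS m) in
    ((x == z) && (y == t)) || ((x == t) && (y == z)))
  side_indices) side_indices) tile_enum) dihedral_indices by vm_compute.
move=> /H/allP/(_ i (mem_tile_enum i))/allP/(_ k (mem_side_indices k))/hasP[m _].
by rewrite /= -eq_set2 => /eqP; exists m.
Qed.

Lemma dihedral_symmetry rs : rs \in dihedral_indices ->
  {g : symmetry | forall i, g i = dihedral rs i}.
Proof.
move=> rsP; pose p := perm (@dihedral_inj rs).
have p_edge e : is_edge e -> is_edge [set p i | i in e].
  case/existsP => i /existsP[k /eqP->]; rewrite imset_set2 !permE is_edgeE.
  have [m /setP/(_ (dihedral rs (nbr i k)))] := dihedral_nbr i k rsP.
  rewrite !inE eqxx /= => /esym/orP[]/eqP->; exact: mem_tnth.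
have p_vertex v : is_vertex v -> is_vertex [set p i | i in v].
  case/existsP => i /existsP[k /eqP->]; rewrite imset_set3 !permE.
  have [m eq_m] := dihedral_nbr i k rsP.
  by apply/existsP; exists (dihedral rs i); apply/existsP; exists m; rewrite -!setUA eq_m.
by exists (Symmetry p_edge p_vertex) => i; rewrite permE.
Qed.

(** * Exhaustive search over two-colourings *)

Definition two_adjacent (p : bitseq) : bool :=
  has (fun xy => xy.1 && xy.2) (zip p (rot 1 p)).

Definition tile_patterns (x : bool) : seq bitseq :=
  let p := if x then [:: true; true; false; false; false]
           else [:: true; false; true; false; false] in
  [seq rot r p | r <- iota 0 5].

(** Size five and two entries [true] leave ten words, five rotations of each pattern. *)
Lemma mem_tile_patterns (p : bitseq) :
  perm_eq p [:: false; false; false; true; true] ->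
  p \in tile_patterns (two_adjacent p).
Proof.
move=> pP; move: (perm_size pP) (seq.permP pP id) => {pP}.
by case: p => [|[] [|[] [|[] [|[] [|[] []]]]]].
Qed.

(** Both orders of a pair are recorded, so that detecting a conflict is a plain lookup. *)
Definition side_colors (i : tile) (p : bitseq) : seq (tile * tile * bool) :=
  [seq (i, jx.1, jx.2) | jx <- zip (nbrs i) p] ++
  [seq (jx.1, i, jx.2) | jx <- zip (nbrs i) p].

Definition dihedral_image (known : seq (tile * tile * bool)) : bool :=
  has (fun rs => all (fun i => all (fun j =>
      (dihedral rs i, dihedral rs j, b_pair i j) \in known)
    (nbrs i)) tile_enum) dihedral_indices.

Arguments dihedral_image : simpl never.

(* [known] lists the colours already chosen; a branch closes when they conflict
   or, once all the tiles of [ts] are filled in, when they form a dihedral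
   image of the standard colouring. *)
Fixpoint search (ps : seq bitseq) (ts : seq tile)
    (known : seq (tile * tile * bool)) : bool :=
  if ts is i :: ts' then
    all (fun p =>
      if has (fun ijx => (ijx.1, ~~ ijx.2) \in known) (side_colors i p) then true
      else search ps ts' (side_colors i p ++ known)) ps
  else dihedral_image known.

Section SearchSound.

Variables (c : tile -> tile -> bool) (ps : seq bitseq).
Hypothesis c_sym : forall i j, c i j = c j i.
Hypothesis c_pattern : forall i, [seq c i j | j <- nbrs i] \in ps.

Lemma side_colorsP i (jkx : tile * tile * bool) :
  jkx \in side_colors i [seq c i j | j <- nbrs i] -> c jkx.1.1 jkx.1.2 = jkx.2.
Proof.
have zipE : zip (nbrs i) [seq c i j | j <- nbrs i] = [seq (j, c i j) | j <- nbrs i].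
  by elim: (tval (nbrs i)) => //= j s ->.
rewrite /side_colors zipE mem_cat => /orP[] /mapP[jx /mapP[j _ ->] ->] //=.
Qed.

(** The entries of [known] agree with [c], so the branch following the actual patterns of [c] never
    conflicts and reaches a leaf, where the dihedral test holds. *)
Lemma search_sound ts known :
  (forall ijx, ijx \in known -> c ijx.1.1 ijx.1.2 = ijx.2) ->
  search ps ts known ->
  exists2 rs, rs \in dihedral_indices &
    forall i k, c (dihedral rs i) (dihedral rs (nbr i k)) = b_pair i (nbr i k).
Proof.
elim: ts known => [|i ts IHts] known knownP /=.
  case/hasP => rs rsP /allP H; exists rs => // i k.
  by have /allP/(_ _ (mem_tnth k _))/knownP := H i (mem_tile_enum i).
move=> /allP/(_ _ (c_pattern i)); case: ifP => [/hasP[jkx /side_colorsP cE]|_].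
  by move=> /knownP /=; rewrite cE; case: jkx.2.
by apply: IHts => jkx; rewrite mem_cat => /orP[/side_colorsP|/knownP].
Qed.

End SearchSound.

(** For [x = false] all branches end in conflicts, as the standard colouring has adjacent
    [b]-sides. *)
Lemma search_ok (x : bool) : search (tile_patterns x) tile_enum [::].
Proof. by case: x; vm_compute. Qed.

(** * From congruent tiles to a common pattern *)

Lemma two_adjacentP (u : 'I_5 -> bool) :
  reflect (exists k, u k && u (ordS k)) (two_adjacent [seq u k | k <- enum 'I_5]).
Proof.
have -> : two_adjacent [seq u k | k <- enum 'I_5] =
          has (fun k => u k && u (ordS k)) side_indices.
  have rotE : rot 1 side_indices = map (@ordS 5) side_indices.
    by apply: (inj_map val_inj).
  rewrite enum_side_indices /two_adjacent -map_rot rotE.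
  by elim: side_indices => //= k s ->.
apply: (iffP hasP) => [[k _]|[k]]; first by exists k.
by exists k => //; apply: mem_side_indices.
Qed.

(** The images of [k] and [ordS k] under [f] are consecutive in one of the two orders, whence the
    two witnesses. *)
Lemma congruent_two_adjacent (u v : 'I_5 -> bool) :
  congruent_sides u v ->
  two_adjacent [seq u k | k <- enum 'I_5] -> two_adjacent [seq v k | k <- enum 'I_5].
Proof.
case=> f [Af uv] /two_adjacentP[k]; rewrite -!uv => /andP[vk vSk].
have : adjacent_sides (f k) (f (ordS k)) by apply: Af; rewrite /adjacent_sides eqxx.
by case/orP => /eqP e; apply/two_adjacentP;
  [exists (f k) | exists (f (ordS k))]; rewrite -e vk vSk.
Qed.

Section Coloring.

Variables (R : realType) (b : R) (len : edge -> R).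

(** Total on pairs of tiles, with default [false] when they share no edge. *)
Definition color (i j : tile) : bool :=
  if (insub [set i; j] : option edge) is Some e then len e == b else false.

Lemma color_sym i j : color i j = color j i.
Proof. by rewrite /color setUC. Qed.

Lemma color_nbr i k : color i (nbr i k) = (len (side i k) == b).
Proof. by rewrite /color (valK (side i k)). Qed.

Lemma color_pattern (a : R) : a != b -> edge_congruent_tiling len ->
  (forall i, perm_eq (tile_lengths len i) [:: a; a; a; b; b]) ->
  exists x, forall i, [seq color i j | j <- nbrs i] \in tile_patterns x.
Proof.
move=> /negPf neq_ab cong lenP; pose u i k := len (side i k) == b.
have colE i : [seq color i j | j <- nbrs i] = [seq u i k | k <- enum 'I_5].
  by rewrite -map_nbr; apply: eq_map => k; rewrite color_nbr.
have cong_u i j : congruent_sides (u i) (u j).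
  by have [f [Af lenf]] := cong i j; exists f; split=> // k; rewrite /u lenf.
exists (two_adjacent [seq u P1 k | k <- enum 'I_5]) => i; rewrite colE.
have -> : two_adjacent [seq u P1 k | k <- enum 'I_5] =
          two_adjacent [seq u i k | k <- enum 'I_5].
  by apply/idP/idP; apply: congruent_two_adjacent.
apply: mem_tile_patterns; rewrite /u (map_comp (fun x => x == b)).
by have := perm_map (fun x => x == b) (lenP i); rewrite /= eqxx neq_ab.
Qed.

End Coloring.

(** * The classification *)

Lemma edgeP (e : edge) : exists i k, e = side i k.
Proof.
case: e => e eP; have /existsP[i /existsP[k /eqP eE]] := eP.
by exists i, k; apply: val_inj.
Qed.

Local Open Scope ring_scope.

Theorem proposition10 (R : realType) (a b : R) (ha : 0 < a) (hb : 0 < b)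
    (hab : a <> b) (len : edge -> R) :
  (edge_congruent_tiling len /\
   forall i : tile, perm_eq (tile_lengths len i) [:: a; a; a; b; b])
  <->
  (exists g : symmetry,
     forall e : edge, len (edge_image g e) = standard_lengths a b e).
Proof.
split=> [[cong lenP]|[g len_g]]; last exact: symmetric_lengths len_g.
have [x patP] := color_pattern (introN eqP hab) cong lenP.
have [//|rs rsP colP] :=
  search_sound (color_sym b len) patP (known := [::]) _ (search_ok x).
have [g gE] := dihedral_symmetry rsP; exists g => e.
(* Colours only tell which lengths equal [b]; the prescribed multiset leaves [a] for the others. *)
have len_ab e' : len e' != b -> len e' = a.
  have [i [k ->]] := edgeP e'.
  have : len (side i k) \in tile_lengths len i by rewrite map_f ?mem_enum.
  by rewrite (perm_mem (lenP i)) !inE; do ![case: eqP => //].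
have [i [k ->]] := edgeP e; rewrite standard_lengths_side -colP -!gE.
(* Naming the image edge by its two tiles lets [insub] in [color] return it. *)
have gik : edge_image g (side i k) \in [pred e' | val e' == [set g i; g (nbr i k)]].
  by rewrite inE /= imset_set2.
rewrite /color -(eqP gik) valK.
by case: eqP => // /eqP/len_ab.
Qed.
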